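(* Let $K(\theta,s)=\sum_{j=0}^{m-1}K^j(\theta)(b_0s)^j$, $W(\theta,s)=\sum_{j=0}^{k-1}W^j(\theta)(bs)^j$ and $\widetilde W(\theta,s)=\sum_{j=0}^{k-1}\widetilde W^j(\theta)(bs)^j$ be as in the context, and assume that $K^j$, $W^j$ and $\widetilde W^j$ are expressed with $n_\theta$ Fourier coefficients. Then the computational complexity of computing the compositions of $K$ with $W$ and with $\widetilde W$ (as polynomials in $s$, on the mesh of $n_\theta$ values of $\theta$), using the table procedure and the non-equispaced fast Fourier transform as described in the context, is $$\Theta\bigl(mk^4n_\theta+mk\,n_\theta\log n_\theta\bigr),$$ and the space complexity is $\Omega(kn_\theta+k^2)$.
   Context: Here $K^j:\mathbb R\to\mathbb R^2$ are $1$-periodic, $W=(W_1,W_2)$ and $\widetilde W=(\widetilde W_1,\widetilde W_2)$ take values in $\mathbb R^2$, with $W^j,\widetilde W^j$ $1$-periodic for $j\ge1$ and $W^0(\theta)-(\theta,0)$, $\widetilde W^0(\theta)-(\theta,0)$ $1$-periodic (for $j=0$ these periodic parts are what is expressed in Fourier coefficients); $b_0,b>0$ are scaling factors. The function $\widetilde W$ is (the truncation in powers of $s$ of) $W\bigl(\theta-\omega r(K(W(\theta,s))),\,s\,e^{-\lambda r(K(W(\theta,s)))}\bigr)$ for given $\omega>0$, $\lambda<0$ and a positive delay function $r$ on $\mathbb R^2$; its coefficients $\widetilde W^j$ are taken as given. A real periodic function is represented by a truncated real Fourier series with $n_\theta$ real coefficients, or equivalently by its values on the uniform mesh $\theta_i=i/n_\theta$,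 $0\le i<n_\theta$. For each mesh value of $\theta$, the composition is computed, truncated at degree $k-1$ in $s$, via $$K\circ W(\theta,s)=\sum_{j=0}^{m-1}K^j(W_1(\theta,s))\,\bigl(b_0W_2(\theta,s)\bigr)^j$$ by Horner's scheme, after computing the polynomials $K^j\circ W_1$ (componentwise) by the table procedure; likewise with $\widetilde W$ in place of $W$. Table procedure. For a periodic function $S$ and a polynomial $q(s)$ of degree $d$ (here $d=k-1$), with the derivatives $\frac{d^l}{d\theta^l}S(q(0))$, $0\le l\le d$, available, put $a_{11}=1$, $a_{i,1}=0$ for $i\ne1$, $a_{ij}=0$ for $j>i$, $a_{2,2}=\frac{d}{ds}q(s)$, and for $2\le j\le i\le d+1$ $$a_{ij}(s)=\frac1{i-1}\Bigl(\frac{d}{ds}a_{i-1,j}(s)+a_{i-1,j-1}(s)\frac{d}{ds}q(s)\Bigr),$$ row $i\ge2$ being computed only up to degree $d+1-i$. The coefficients of $S\circ q$ up to order $d$ are $p_j=\sum_{l=0}^{d}a_{j+1,l+1}(0)\frac{d^l}{d\theta^l}S(q(0))$. Non-equispaced fast Fourier transform (package NFFT3). The required values $\frac{d^i}{d\theta^i}K^j(W^0_1(\theta))$ and $\frac{d^i}{d\theta^i}K^j(\widetilde W^0_1(\theta))$, $0\le i\le k-1$, $0\le j\le m-1$, at the mesh points are obtained with an algorithm which evaluates a trigonometric polynomial with $n_\theta$ Fourier coefficients at $n_\theta$ (an even number of) arbitrary, non-equispaced nodes in $\Theta(n_\theta\log n_\theta)$ operations. Complexity counts arithmetic operations; polynomial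 products are done by the classical (schoolbook) method. Space counts stored real coefficients. *)

(* Defs.v *)
From mathcomp Require Import all_boot all_order all_algebra.
From mathcomp Require Import all_classical all_reals all_analysis.

Set Implicit Arguments.
Unset Strict Implicit.
Unset Printing Implicit Defensive.

Import Order.TTheory GRing.Theory Num.Theory.
Import numFieldNormedType.Exports.

Local Open Scope classical_set_scope.
Local Open Scope ring_scope.

(* Programs are instrumented with the number of arithmetic operations performed
   so far, the number of real coefficients currently in memory, and the maximum
   of the latter since the beginning. *)
Record usage := Usage { ops : nat; live : nat; peak : nat }.

Definition prog (A : Type) : Type := usage -> A * usage.

Definition ret {A : Type} (x : A) : prog A := fun u => (x, u).

Definition bind {A B : Type} (p : prog A) (f : A -> prog B) : prog B :=
  fun u => let: (x, u') := p u in f x u'.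

Notation "'let*' x := p 'in' q" := (bind p (fun x => q))
  (at level 200, x name, p at level 100, q at level 200,
   format "'[v' 'let*'  x  :=  p  'in' '/' q ']'").

Definition tick (c : nat) : prog unit :=
  fun u => (tt, Usage (ops u + c) (live u) (peak u)).

Definition alloc (c : nat) : prog unit :=
  fun u => (tt, Usage (ops u) (live u + c) (maxn (peak u) (live u + c))).

Definition release (c : nat) : prog unit :=
  fun u => (tt, Usage (ops u) (live u - c) (peak u)).

Fixpoint mapM {A B : Type} (f : A -> prog B) (s : seq A) : prog (seq B) :=
  if s is a :: s' then
    let* b := f a in
    let* bs := mapM f s' in
    ret (b :: bs)
  else ret [::].

Fixpoint foldM {A B : Type} (f : B -> A -> prog B) (b : B) (s : seq A) : prog B :=
  if s is a :: s' then let* b' := f b a in foldM f b' s' else ret b.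

(* The result of [p] is a real coefficient that is kept in memory; other
   intermediate scalars are not counted as storage. *)
Definition stored {A : Type} (p : prog A) : prog A :=
  let* x := p in
  let* _ := alloc 1 in
  ret x.

Definition tabulate {A : Type} (n : nat) (f : nat -> prog A) : prog (seq A) :=
  mapM (fun i => stored (f i)) (iota 0 n).

(* A polynomial in [s] is the array of its coefficients, lowest degree first;
   entries beyond the end of the array are 0, and [[::]] is the zero
   polynomial, which takes no memory. *)
Section PolynomialPrograms.
Variable F : fieldType.
Implicit Types (x y : F) (p q w : seq F) (row : seq (seq F)).

Definition addM x y : prog F := let* _ := tick 1 in ret (x + y).
Definition mulM x y : prog F := let* _ := tick 1 in ret (x * y).
Definition divM x y : prog F := let* _ := tick 1 in ret (x / y).
Definition oppM x : prog F := let* _ := tick 1 in ret (- x).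

(* [f 0 + ... + f n.-1], with [n.-1] additions *)
Fixpoint sumM (n : nat) (f : nat -> prog F) : prog F :=
  match n with
  | 0 => ret 0
  | n'.+1 =>
      if n' is 0 then f 0%N
      else let* a := sumM n' f in let* b := f n' in addM a b
  end.

(* [:: x; x * y; ...; x * y ^ n.-1] *)
Fixpoint powersM (n : nat) x y : prog (seq F) :=
  if n is n'.+1 then
    let* _ := alloc 1 in
    let* x' := mulM x y in
    let* s := powersM n' x' y in
    ret (x :: s)
  else ret [::].

(* coefficients of degree [t] of the schoolbook product and of the derivative *)
Definition mul_coefM p q (t : nat) : prog F :=
  sumM t.+1 (fun i => mulM p`_i q`_(t - i)).
Definition deriv_coefM p (t : nat) : prog F := mulM t.+1%:R p`_t.+1.

(* A row [i] of the table is the array of its polynomials [a_{i,1}, ...,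
   a_{i,i}]; the entries beyond the diagonal are the default value 0. *)
Definition entry row (j : nat) : seq F := nth [::] row j.-1.

Definition table_coefM (dq : seq F) (i : nat) (prev : seq (seq F)) (j t : nat) :
    prog F :=
  let* a := deriv_coefM (entry prev j) t in
  let* c := mul_coefM (entry prev j.-1) dq t in
  let* e := addM a c in
  divM e i.-1%:R.

(* Row [i >= 2] is computed up to degree [d + 1 - i]; [dq] is the derivative of
   [q], and [prev] the row [i.-1]. *)
Definition table_rowM (d : nat) (dq : seq F) (i : nat) (prev : seq (seq F)) :
    prog (seq (seq F)) :=
  match i with
  | 1 => let* _ := alloc 1 in ret [:: [:: 1]]
  | 2 => let* _ := alloc (size dq) in ret [:: [::]; dq]
  | _ => let* r := mapM (fun j => tabulate (d.+2 - i) (table_coefM dq i prev j))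
                        (iota 2 i.-1) in
         ret ([::] :: r)
  end.

(* Computes rows [i, ..., i + r - 1] from row [i.-1] and returns
   [p_{i-1}, ..., p_{i+r-2}].  Only the previous row is kept in memory. *)
Fixpoint table_loopM (d : nat) (dq Sq : seq F) (r i : nat) (prev : seq (seq F)) :
    prog (seq F) :=
  if r is r'.+1 then
    let* row := table_rowM d dq i prev in
    let* _ := release (sumn (map size prev)) in
    let* p := stored (sumM d.+1 (fun l => mulM (entry row l.+1)`_0 Sq`_l)) in
    let* ps := table_loopM d dq Sq r' i.+1 row in
    ret (p :: ps)
  else
    let* _ := release (sumn (map size prev)) in ret [::].

(* Table procedure: the coefficients up to order [d] of [S \o q], given the
   coefficients of [q] and the list [Sq] of the derivatives
   [S^(l) (q 0)], 0 <= l <= d. *)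
Definition tableM (d : nat) q (Sq : seq F) : prog (seq F) :=
  let* dq := tabulate d (deriv_coefM q) in
  let* p := table_loopM d dq Sq d.+1 1 [::] in
  let* _ := release (size dq) in
  ret p.

(* Horner's scheme for [\sum_j P_j * w ^ j], truncated at degree [d]. *)
Definition horner_stepM (d : nat) w (acc p : seq F) : prog (seq F) :=
  let* r := tabulate d.+1 (fun t =>
              let* c := mul_coefM acc w t in addM c p`_t) in
  let* _ := release (size acc + size p) in
  ret r.

Definition horner_schemeM (d : nat) w (P : seq (seq F)) : prog (seq F) :=
  if rev P is p :: P' then foldM (horner_stepM d w) p P' else ret [::].

(* One component of [K \o W] at a mesh point: [q] and [w] are the polynomials
   [W_1] and [b0 * W_2], and [DK] lists, for each [j], the derivatives of [K^j]
   at [q 0].  The table procedure is run anew for every [j]. *)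
Definition composeM (d : nat) q w (DK : seq (seq F)) : prog (seq F) :=
  let* P := mapM (tableM d q) DK in
  horner_schemeM d w P.

End PolynomialPrograms.

Section FourierPrograms.
Variable R : realType.

(* A trigonometric polynomial is given by its cosine and sine coefficients in
   increasing order of the frequency. *)
Definition trig_eval (ab : seq (R * R)) (x : R) : R :=
  \sum_(l < size ab) ((nth 0 ab l).1 * cos (2 * pi * l%:R * x)
                      + (nth 0 ab l).2 * sin (2 * pi * l%:R * x)).

(* A real trigonometric polynomial with [n] real coefficients, [n] even:
   [c_0, ..., c_{n/2}] are the coefficients of the cosines, and
   [c_{n/2+1}, ..., c_{n-1}] those of the sines of frequencies 1 to n/2 - 1.
   Its odd derivatives have a sine of frequency n/2, whence the pairs. *)
Definition trig_of_fourier (n : nat) (c : seq R) : seq (R * R) :=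
  mkseq (fun l => (c`_l, if (0 < l < n./2)%N then c`_(n./2 + l) else 0))
        (n./2).+1.

Definition trig_derivM (ab : seq (R * R)) : prog (seq (R * R)) :=
  mapM (fun l =>
          let* f := mulM (2 * pi) l%:R in
          let* a := stored (mulM f (nth 0 ab l).2) in
          let* c := mulM f (nth 0 ab l).1 in
          let* b := stored (oppM c) in
          ret (a, b))
       (iota 0 (size ab)).

Variables nfft_ops nfft_work : nat -> nat.

(* The non-equispaced fast Fourier transform, a black box which evaluates a
   trigonometric polynomial at [n] nodes in [nfft_ops n] operations, with a
   workspace of [nfft_work n] reals. *)
Definition nfftM (ab : seq (R * R)) (xs : seq R) : prog (seq R) :=
  let* _ := tick (nfft_ops (size xs)) in
  let* _ := alloc (nfft_work (size xs)) in
  let* v := mapM (fun x => stored (ret (trig_eval ab x))) xs in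
  let* _ := release (nfft_work (size xs)) in
  ret v.

Fixpoint nfft_derivs_loopM (r : nat) (ab : seq (R * R)) (xs : seq R) :
    prog (seq (seq R)) :=
  if r is r'.+1 then
    let* ab' := trig_derivM ab in
    let* _ := release (2 * size ab) in
    let* v := nfftM ab' xs in
    let* vs := nfft_derivs_loopM r' ab' xs in
    ret (v :: vs)
  else
    let* _ := release (2 * size ab) in ret [::].

(* The values at the nodes [xs] of the derivatives of orders [0, ..., k.-1] of
   the function with Fourier coefficients [c], one array for each order. *)
Definition nfft_derivsM (k n : nat) (c xs : seq R) : prog (seq (seq R)) :=
  let ab := trig_of_fourier n c in
  let* _ := alloc (2 * size ab) in
  let* v := nfftM ab xs in
  let* vs := nfft_derivs_loopM k.-1 ab xs in
  ret (v :: vs).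

(* [K] and [W] have [terms_K] and [terms_W] terms, i.e., [m] and [k].  The
   function [K] is given by the [n] Fourier coefficients (in R^2) of each [K^j]; [W] and [Wt] by the [n] values (in R^2) of each [W^j] on the uniform
   mesh, those of the periodic part [W^0 (theta) - (theta, 0)] for [j = 0]. *)
Record composition_data := CompositionData {
  terms_K : nat;
  terms_W : nat;
  n_mesh : nat;
  terms_K_gt0 : (0 < terms_K)%N;
  terms_W_gt0 : (0 < terms_W)%N;
  n_mesh_gt0 : (0 < n_mesh)%N;
  n_mesh_even : ~~ odd n_mesh;
  scale_K : R;
  scale_W : R;
  scale_K_gt0 : 0 < scale_K;
  scale_W_gt0 : 0 < scale_W;
  coef_K : terms_K.-tuple (n_mesh.-tuple (R * R));
  mesh_W : terms_W.-tuple (n_mesh.-tuple (R * R));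
  mesh_Wt : terms_W.-tuple (n_mesh.-tuple (R * R)) }.

(* Polynomials [W_1] and [b0 * W_2] in [s] at the mesh point [i / n], from the
   list [bp] of the powers of [b]. *)
Definition mesh_poly1M (k n : nat) (bp : seq R) (W : seq (seq (R * R))) (i : nat) :
    prog (seq R) :=
  tabulate k (fun j =>
    let* c := mulM bp`_j (nth 0 (nth [::] W j) i).1 in
    if j == 0%N then let* theta := divM i%:R n%:R in addM theta c else ret c).

Definition mesh_poly2M (k : nat) (b0 : R) (bp : seq R) (W : seq (seq (R * R)))
    (i : nat) : prog (seq R) :=
  tabulate k (fun j =>
    let* c := mulM bp`_j (nth 0 (nth [::] W j) i).2 in mulM b0 c).

(* [K \o W] on the mesh: for each mesh point, the two polynomials in [s]. *)
Definition compose_meshM (m k n : nat) (b0 b : R) (K W : seq (seq (R * R))) :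
    prog (seq (seq R * seq R)) :=
  let* bp := powersM k 1 b in
  let* qs := mapM (mesh_poly1M k n bp W) (iota 0 n) in
  let* ws := mapM (mesh_poly2M k b0 bp W) (iota 0 n) in
  let xs := [seq q`_0 | q <- qs] in
  let* D1 := mapM (fun c => nfft_derivsM k n (unzip1 c) xs) K in
  let* D2 := mapM (fun c => nfft_derivsM k n (unzip2 c) xs) K in
  let at_mesh (D : seq (seq (seq R))) i := [seq [seq v`_i | v <- Dj] | Dj <- D] in
  let* res := mapM (fun i =>
      let* p1 := composeM k.-1 (nth [::] qs i) (nth [::] ws i) (at_mesh D1 i) in
      let* p2 := composeM k.-1 (nth [::] qs i) (nth [::] ws i) (at_mesh D2 i) in
      ret (p1, p2)) (iota 0 n) in
  let* _ := release (k + 2 * (n * k) + 2 * (m * k * n)) in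
  ret res.

Definition compositionsM (P : composition_data) :
    prog (seq (seq R * seq R) * seq (seq R * seq R)) :=
  let K := [seq val c | c <- coef_K P] in
  let W := [seq val c | c <- mesh_W P] in
  let Wt := [seq val c | c <- mesh_Wt P] in
  let comp := compose_meshM (terms_K P) (terms_W P) (n_mesh P) (scale_K P) (scale_W P) K in
  let* KW := comp W in
  let* KWt := comp Wt in
  ret (KW, KWt).

(* Initially the Fourier coefficients of [K] and the values of [W] and [Wt] are
   in memory. *)
Definition initial_usage (P : composition_data) : usage :=
  let c := (2 * (terms_K P * n_mesh P) + 4 * (terms_W P * n_mesh P))%N in
  Usage 0 c c.

Definition arithmetic_cost (P : composition_data) : nat :=
  ops (compositionsM P (initial_usage P)).2.

Definition storage_cost (P : composition_data) : nat :=
  peak (compositionsM P (initial_usage P)).2.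

End FourierPrograms.

(* Main.v *)
Require Import Defs.
From mathcomp Require Import all_boot all_order all_algebra.
From mathcomp Require Import all_classical all_reals all_analysis.
From mathcomp Require Import zify lra.
Import Order.TTheory GRing.Theory Num.Theory.
Import numFieldNormedType.Exports.
Local Open Scope classical_set_scope.
Local Open Scope ring_scope.

Set Implicit Arguments.
Unset Strict Implicit.
Unset Printing Implicit Defensive.

(** The number of operations depends only on the sizes m, k and n, never on the
values of the coefficients, so that it can be computed exactly.  The dominant
part is the table: its row with e coefficients in each entry has k - e computed
entries, and the coefficients of one entry cost e (e + 3) operations, so that
one table takes
  d + k (2 k - 1) + sum_(e < k - 1) e (e + 3) (k - e)    (d = k - 1)
operations.  The sum is a polynomial in k of degree 4, and [table_cost_bounds]
encloses the total between k^4 / 12 and k^4.  There are 2 m tables at each of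
the n mesh points and for each of the two compositions, and the Horner steps,
of cost k (k + 1), and the evaluation of the mesh polynomials are dominated by
them.  The other part consists of 4 m k calls of the Fourier transform F(n), so
that the cost is comparable to m k^4 n + m k F(n), uniformly in m, k and n
([composition_cost_bounds]).

It remains to replace F(n) by n ln n.  The hypothesis compares the two for
large n only; but the finitely many other n cost an error O(n) in both
directions ([Theta_even_bounds]), which is absorbed by the term m k^4 n.

For the storage, the data already take 4 k n coefficients, and when the middle
row of a table is complete, about k^2 / 4 coefficients are in memory.

The operations are counted by two compositional predicates: [builds], which is
exact, for programs that never release memory, and [runs], which keeps the exact
number of operations but only a lower bound of the peak of memory. *)

(** * Counting the operations and the memory of programs *)

Section Usage.
Local Open Scope nat_scope.

(** [p] performs [c] operations and adds [a] coefficients to the memory.  As it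
releases nothing, the peak is determined by the final state.  The hypothesis
[live u <= peak u], satisfied by every state that a run reaches, is what
makes the case [a = 0] neutral. *)
Definition builds A (p : prog A) (c a : nat) : Prop :=
  forall u, (live u <= peak u ->
    (p u).2 = Usage (ops u + c) (live u + a) (maxn (peak u) (live u + a)))%N.

(** [p] performs [c] operations, and at some moment at least [h] coefficients are
in memory.  As [release] truncates the subtraction, nothing is said of the
final content of the memory; a bound of the peak is not affected by later
releases. *)
Definition runs A (p : prog A) (c h : nat) : Prop :=
  forall u, (live u <= peak u ->
    [/\ ops (p u).2 = ops u + c, maxn (peak u) h <= peak (p u).2
      & live (p u).2 <= peak (p u).2])%N.

Lemma bindE A B (p : prog A) (f : A -> prog B) u :
  bind p f u = f (p u).1 (p u).2.
Proof. by rewrite /bind; case: (p u). Qed.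

Lemma size_mapM A B (f : A -> prog B) s u : size (mapM f s u).1 = size s.
Proof. by elim: s u => [|a s IHs] u //=; rewrite !bindE /= IHs. Qed.

Lemma builds_eq A (p : prog A) c a c' a' :
  builds p c a -> c = c' -> a = a' -> builds p c' a'.
Proof. by move=> pP <- <-. Qed.

Lemma runs_weaken A (p : prog A) c h c' h' :
  runs p c h -> c = c' -> h' <= h -> runs p c' h'.
Proof. by move=> pP <- hh u /pP [-> ? ?]; split=> //; lia. Qed.

Lemma builds_runs A (p : prog A) c a : builds p c a -> runs p c a.
Proof. by move=> pP u lu; rewrite pP //=; split=> //; lia. Qed.

Lemma builds_ret A (x : A) : builds (ret x) 0 0.
Proof. by move=> [c0 l k] /= lk; rewrite !addn0 (maxn_idPl lk). Qed.

Lemma builds_tick c : builds (tick c) c 0.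
Proof. by move=> [c0 l k] /= lk; rewrite !addn0 (maxn_idPl lk). Qed.

Lemma builds_alloc a : builds (alloc a) 0 a.
Proof. by move=> [c0 l k] /= lk; rewrite addn0. Qed.

Lemma runs_release c : runs (release c) 0 0.
Proof. by move=> u lu /=; split; lia. Qed.

(** The continuation is only required to be well behaved on values that [p]
returns: this is how the size of an intermediate array enters a later cost. *)
Lemma builds_bind A B (p : prog A) (f : A -> prog B) c1 a1 c2 a2 :
  builds p c1 a1 -> (forall u, builds (f (p u).1) c2 a2) ->
  builds (bind p f) (c1 + c2) (a1 + a2).
Proof.
move=> pP fP u lu; rewrite bindE fP pP //=; last by rewrite leq_maxr.
by congr Usage; lia.
Qed.

Lemma runs_bind A B (p : prog A) (f : A -> prog B) c1 h1 c2 h2 :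
  runs p c1 h1 -> (forall u, runs (f (p u).1) c2 h2) ->
  runs (bind p f) (c1 + c2) (maxn h1 h2).
Proof.
move=> pP fP u lu; have [op hp lp] := pP u lu.
by have [of' hf lf] := fP u _ lp; rewrite bindE of' op; split=> //; lia.
Qed.

End Usage.

Create HintDb usage.
#[local] Hint Resolve builds_ret builds_tick builds_alloc runs_release : usage.
#[local] Hint Resolve builds_runs | 10 : usage.

(** Follows the structure of a program, with the costs of the parts as existential
variables; [total] then compares the sum that is found with the claimed one. *)
Ltac account :=
  lazymatch goal with
  | |- builds (bind _ _) _ _ =>
      eapply builds_bind; [account | intro; cbv beta; account]
  | |- runs (bind _ _) _ _ =>
      eapply runs_bind; [account | intro; cbv beta; account]
  | |- _ => solve [eauto 3 with usage]
  end.

Ltac total := first [eapply builds_eq | eapply runs_weaken]; [account | lia | lia].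

Section Iteration.
Local Open Scope nat_scope.

Lemma builds_stored A (p : prog A) c : builds p c 0 -> builds (stored p) c 1.
Proof. by move=> pP; rewrite /stored; total. Qed.

Lemma builds_mapM A B (f : A -> prog B) (c a : A -> nat) s :
  (forall x, builds (f x) (c x) (a x)) ->
  builds (mapM f s) (\sum_(x <- s) c x) (\sum_(x <- s) a x).
Proof.
move=> fP; elim: s => [|x s IHs] /=; first by rewrite !big_nil; exact: builds_ret.
by rewrite !big_cons; total.
Qed.

Lemma sum_const_seq A (s : seq A) c : \sum_(x <- s) c = size s * c.
Proof. by rewrite big_const_seq count_predT iter_addn_0 mulnC. Qed.

Lemma builds_tabulate A n (f : nat -> prog A) (c : nat -> nat) :
  (forall i, builds (f i) (c i) 0) ->
  builds (tabulate n f) (\sum_(0 <= i < n) c i) n.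
Proof.
move=> fP; have := builds_mapM (iota 0 n) (fun i => builds_stored (fP i)).
by rewrite sum_const_seq size_iota muln1 /index_iota subn0.
Qed.

Lemma builds_tabulate_const A n (f : nat -> prog A) c :
  (forall i, builds (f i) c 0) -> builds (tabulate n f) (n * c) n.
Proof. by move/(builds_tabulate n); rewrite sum_nat_const_nat subn0. Qed.

Lemma runs_mapM A B (f : A -> prog B) c h s :
  (forall x, runs (f x) c h) -> runs (mapM f s) (size s * c) (h * (0 < size s)).
Proof.
move=> fP; elim: s => [|x s IHs] /=; first by rewrite muln0; account.
total.
Qed.

Lemma runs_foldM A B (f : B -> A -> prog B) c b s :
  (forall b x, runs (f b x) c 0) -> runs (foldM f b s) (size s * c) 0.
Proof.
by move=> fP; elim: s b => [|x s IHs] b /=; [account | total].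
Qed.

End Iteration.

(** * The table procedure and Horner's scheme *)

Section Polynomials.
Local Open Scope nat_scope.
Variable F : fieldType.
Implicit Types (x y : F) (p q w : seq F).

Lemma builds_addM x y : builds (addM x y) 1 0.
Proof. by rewrite /addM; total. Qed.

Lemma builds_mulM x y : builds (mulM x y) 1 0.
Proof. by rewrite /mulM; total. Qed.

Lemma builds_divM x y : builds (divM x y) 1 0.
Proof. by rewrite /divM; total. Qed.

Lemma builds_oppM x : builds (oppM x) 1 0.
Proof. by rewrite /oppM; total. Qed.

Hint Resolve builds_addM builds_mulM builds_divM builds_oppM : usage.

Lemma builds_sumM n (f : nat -> prog F) c :
  (forall i, builds (f i) c 0) -> builds (sumM n.+1 f) (n.+1 * c + n) 0.
Proof.
move=> fP; elim: n => [|n IHn]; first by apply: (builds_eq (fP 0)); lia.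
change (sumM n.+2 f) with (let* a := sumM n.+1 f in let* b := f n.+1 in addM a b).
total.
Qed.

Arguments sumM : simpl never.

Lemma builds_powersM n x y : builds (powersM n x y) n n.
Proof. by elim: n x => [|n IHn] x /=; total. Qed.

Lemma builds_mul_coefM p q t : builds (mul_coefM p q t) (2 * t + 1) 0.
Proof.
by apply: builds_eq; [apply: builds_sumM => i; exact: builds_mulM | lia | lia].
Qed.

Lemma builds_deriv_coefM p t : builds (deriv_coefM p t) 1 0.
Proof. exact: builds_mulM. Qed.

Hint Resolve builds_mul_coefM builds_deriv_coefM : usage.

Lemma builds_table_coefM (dq : seq F) i prev j t :
  builds (table_coefM dq i prev j t) (2 * t + 4) 0.
Proof. by rewrite /table_coefM; total. Qed.

(** The row is never released while it is computed, hence a peak of at least its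
size whatever was in memory before. *)
Lemma builds_table_rowM d (dq : seq F) i prev : 2 < i -> let e := d.+2 - i in
  builds (table_rowM d dq i prev) (i.-1 * (e * (e + 3))) (i.-1 * e).
Proof.
case: i => [|[|[|i]]] // _ e.
have sumE : \sum_(0 <= t < e) (2 * t + 4) = e * (e + 3).
  elim: (e) => [|e' IHe]; first by rewrite big_geq.
  by rewrite big_nat_recr //= IHe; lia.
have rowP j := builds_tabulate e (builds_table_coefM dq i.+3 prev j).
have := builds_mapM (iota 2 i.+2) rowP.
rewrite sumE !sum_const_seq size_iota => {}rowP.
by rewrite /table_rowM; total.
Qed.

(** The rows with less than [r] coefficients per entry, indexed by this number
[e] rather than by [i = d + 2 - e]: in the loop, [e] is the number of rows still
to be computed, this one included. *)
Definition rows_cost d r : nat := \sum_(e < r) e * (e + 3) * (d.+1 - e).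

Definition rows_peak d r : nat := \max_(e < r) e * (d.+1 - e).

Lemma rows_costS d r :
  rows_cost d r.+1 = rows_cost d r + r * (r + 3) * (d.+1 - r).
Proof. exact: big_ord_recr. Qed.

Lemma rows_peakS d r : rows_peak d r.+1 = maxn (rows_peak d r) (r * (d.+1 - r)).
Proof. exact: big_ord_recr. Qed.

Definition table_cost d : nat := d + d.+1 * (2 * d + 1) + rows_cost d d.

Lemma builds_table_result d row (Sq : seq F) :
  builds (stored (sumM d.+1 (fun l => mulM (entry row l.+1)`_0 Sq`_l)))
         (2 * d + 1) 1.
Proof.
apply: builds_stored.
by apply: builds_eq; [apply: builds_sumM => i; exact: builds_mulM | lia | lia].
Qed.

Hint Resolve builds_table_result : usage.

Lemma runs_table_loopM d dq (Sq : seq F) r i prev : 2 < i -> i + r = d.+2 ->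
  runs (table_loopM d dq Sq r i prev)
       (r * (2 * d + 1) + rows_cost d r.+1)
       (rows_peak d r.+1).
Proof.
elim: r i prev => [|r IHr] i prev i_gt2 ir.
  by rewrite rows_costS rows_peakS /rows_cost /rows_peak !big_ord0 /=; total.
rewrite (rows_costS d r.+1) (rows_peakS d r.+1) /=.
have rowP := builds_runs (builds_table_rowM d dq prev i_gt2).
have eE : d.+2 - i = r.+1 by lia.
have iE : i.-1 = d.+1 - r.+1 by lia.
rewrite /= eE iE ![(d.+1 - r.+1) * _]mulnC in rowP.
have tailP row : runs (table_loopM d dq Sq r i.+1 row) _ _ :=
  IHr i.+1 row (ltnW i_gt2) ltac:(lia).
total.
Qed.

Lemma runs_tableM d q (Sq : seq F) :
  runs (tableM d q Sq) (table_cost d) (rows_peak d d).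
Proof.
have dqP := builds_tabulate_const d (builds_deriv_coefM q).
suff loopP dq : runs (table_loopM d dq Sq d.+1 1 [::])
  (d.+1 * (2 * d + 1) + rows_cost d d) (rows_peak d d).
  by rewrite /tableM /table_cost; total.
case: d {dqP} => [|d].
  by rewrite /rows_cost /rows_peak !big_ord0 /=; total.
(* Rows 1 and 2 require no operation; the loop reaches row 3. *)
have tailP row := @runs_table_loopM d.+1 dq Sq d 3 row isT erefl.
rewrite /=.
total.
Qed.

Definition horner_cost d : nat := d.+1 * d.+2.

Lemma runs_horner_stepM d w acc p : runs (horner_stepM d w acc p) (horner_cost d) 0.
Proof.
have stepP t : builds (let* c := mul_coefM acc w t in addM c p`_t) (2 * t + 2) 0.
  by total.
have {}stepP := builds_tabulate d.+1 stepP.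
have sumE : \sum_(0 <= t < d.+1) (2 * t + 2) = d.+1 * d.+2.
  elim: d.+1 => [|e IHe]; first by rewrite big_geq.
  by rewrite big_nat_recr //= IHe; lia.
by rewrite sumE in stepP; rewrite /horner_stepM /horner_cost; total.
Qed.

Lemma runs_horner_schemeM d w P :
  runs (horner_schemeM d w P) ((size P).-1 * horner_cost d) 0.
Proof.
rewrite -(size_rev P) /horner_schemeM; case: (rev P) => [|p P'] /=; first by account.
exact: runs_foldM (runs_horner_stepM d w).
Qed.

Lemma runs_composeM d q w (DK : seq (seq F)) : 0 < size DK ->
  runs (composeM d q w DK)
       (size DK * table_cost d + (size DK).-1 * horner_cost d) (rows_peak d d).
Proof.
move=> DK_gt0; have tablesP := runs_mapM DK (runs_tableM d q).
apply: runs_weaken.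
- apply: (runs_bind tablesP) => u.
  by have := runs_horner_schemeM d w (mapM (tableM d q) DK u).1; rewrite size_mapM; apply.
- by [].
- by rewrite DK_gt0; lia.
Qed.

End Polynomials.

#[local] Hint Resolve builds_addM builds_mulM builds_divM builds_oppM
  builds_powersM : usage.

(** * The Fourier transforms and the compositions on the mesh *)

Section Fourier.
Local Open Scope nat_scope.
Variables (R : realType) (nfft_ops nfft_work : nat -> nat).
Implicit Types (ab : seq (R * R)) (c xs : seq R).

Lemma builds_trig_derivM ab :
  builds (trig_derivM ab) (4 * size ab) (2 * size ab).
Proof.
have stepP l : builds (
    let* f := mulM (2 * pi)%R l%:R in
    let* a := stored (mulM f (nth 0%R ab l).2) in
    let* c := mulM f (nth 0%R ab l).1 in
    let* b := stored (oppM c) in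
    ret (a, b)) 4 2.
  have storedP (x y : R) := builds_stored (builds_mulM x y).
  have stored_oppP (x : R) := builds_stored (builds_oppM x).
  by total.
have := builds_mapM (iota 0 (size ab)) stepP.
by rewrite !sum_const_seq size_iota => derivP; apply: (builds_eq derivP); lia.
Qed.

Lemma runs_nfftM ab xs : runs (nfftM nfft_ops nfft_work ab xs) (nfft_ops (size xs)) 0.
Proof.
have evalP := builds_mapM xs (fun x => builds_stored (builds_ret (trig_eval ab x))).
by rewrite !sum_const_seq in evalP; rewrite /nfftM; total.
Qed.

Lemma runs_nfft_derivs_loopM r ab xs :
  runs (nfft_derivs_loopM nfft_ops nfft_work r ab xs)
       (r * (nfft_ops (size xs) + 4 * size ab)) 0.
Proof.
elim: r ab => [|r IHr] ab /=; first by total.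
have derivP := builds_trig_derivM ab.
have nfftP := runs_nfftM _ xs.
have tailP u : runs (nfft_derivs_loopM nfft_ops nfft_work r (trig_derivM ab u).1 xs)
    (r * (nfft_ops (size xs) + 4 * size ab)) 0.
  by have := IHr (trig_derivM ab u).1; rewrite size_mapM size_iota.
total.
Qed.

Lemma runs_nfft_derivsM k n c xs : 0 < k -> size xs = n ->
  runs (nfft_derivsM nfft_ops nfft_work k n c xs)
       (k * nfft_ops n + k.-1 * (4 * n./2.+1)) 0.
Proof.
move=> k_gt0 <-; set ab := trig_of_fourier (size xs) c.
have nfftP := runs_nfftM ab xs.
have := runs_nfft_derivs_loopM k.-1 ab xs; rewrite {2}/ab size_mkseq => loopP.
rewrite /nfft_derivsM -/ab.
rewrite -{2}(prednK k_gt0) mulSn; total.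
Qed.

Lemma runs_mesh_poly1M k n (bp : seq R) W i : 0 < k ->
  runs (mesh_poly1M k n bp W i) (k + 2) 0.
Proof.
move=> k_gt0; rewrite /mesh_poly1M.
have coefP j : builds (
    let* c := mulM (bp`_j)%R (nth 0%R (nth [::] W j) i).1 in
    if j == 0 then let* theta := divM i%:R n%:R in addM theta c else ret c)
    (1 + 2 * (j == 0)) 0.
  by case: eqP => _; total.
apply: runs_weaken; first exact: builds_runs (builds_tabulate k coefP).
  rewrite big_ltn // eqxx big_add1 (eq_bigr (fun=> 1)) // sum_nat_const_nat; lia.
by [].
Qed.

Lemma runs_mesh_poly2M k b0 (bp : seq R) W i :
  runs (mesh_poly2M k b0 bp W i) (k * 2) 0.
Proof.
have coefP j : builds (
    let* c := mulM (bp`_j)%R (nth 0%R (nth [::] W j) i).2 in mulM b0 c) 2 0 by total.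
exact: runs_weaken (builds_runs (builds_tabulate_const k coefP)) _ _.
Qed.

Definition composition_cost m k n : nat :=
  k + n * (k + 2) + n * (k * 2)
  + 2 * (m * (k * nfft_ops n + k.-1 * (4 * n./2.+1)))
  + n * (2 * (m * table_cost k.-1 + m.-1 * horner_cost k.-1)).

Lemma runs_compose_meshM m k n b0 b (K W : seq (seq (R * R))) :
  0 < m -> 0 < k -> 0 < n -> size K = m ->
  runs (compose_meshM nfft_ops nfft_work m k n b0 b K W)
       (composition_cost m k n) (rows_peak k.-1 k.-1).
Proof.
move=> m_gt0 k_gt0 n_gt0 sK; rewrite /compose_meshM /composition_cost.
set d := k.-1.
have bpP := builds_powersM k 1%R b.
apply: runs_weaken.
  apply: (runs_bind (builds_runs bpP)) => u1.
  apply: (runs_bind (runs_mapM _ (fun i => runs_mesh_poly1M n _ W i k_gt0))) => u2.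
  apply: (runs_bind (runs_mapM _ (fun i => runs_mesh_poly2M k b0 _ W i))) => u3.
  set qs := (mapM _ _ u2).1.
  have xsP : size [seq (q`_0)%R | q : seq R <- qs] = n.
    by rewrite size_map size_mapM size_iota.
  apply: runs_bind => [|u4].
    by apply: runs_mapM => c; exact: runs_nfft_derivsM xsP.
  apply: runs_bind => [|u5].
    by apply: runs_mapM => c; exact: runs_nfft_derivsM xsP.
  set D1 := (mapM _ _ u4).1; set D2 := (mapM _ _ u5).1.
  have D1P : size D1 = m by rewrite size_mapM.
  have D2P : size D2 = m by rewrite size_mapM.
  have composeP q w D i : size D = m ->
      runs (composeM d q w [seq [seq (v`_i)%R | v : seq R <- Dj] | Dj <- D])
           (m * table_cost d + m.-1 * horner_cost d) (rows_peak d d).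
    move=> sD; have := @runs_composeM R d q w [seq [seq (v`_i)%R | v : seq R <- Dj] | Dj <- D].
    by rewrite size_map sD; apply.
  apply: runs_bind => [|u6].
    apply: runs_mapM => i.
    apply: (runs_bind (composeP _ _ _ i D1P)) => u7.
    apply: (runs_bind (composeP _ _ _ i D2P)) => u8.
    by account.
  apply: (runs_bind (runs_release _)) => u9; by account.
- by rewrite !size_iota sK; lia.
- by rewrite size_iota n_gt0 muln1; lia.
Qed.

Lemma runs_compositionsM (P : composition_data R) :
  runs (compositionsM nfft_ops nfft_work P)
       (2 * composition_cost (terms_K P) (terms_W P) (n_mesh P))
       (rows_peak (terms_W P).-1 (terms_W P).-1).
Proof.
have compP (K W : seq (seq (R * R))) b0 b : size K = terms_K P -> runs
    (compose_meshM nfft_ops nfft_work (terms_K P) (terms_W P) (n_mesh P) b0 b K W)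
    (composition_cost (terms_K P) (terms_W P) (n_mesh P))
    (rows_peak (terms_W P).-1 (terms_W P).-1).
  move=> sK.
  by apply: runs_compose_meshM => //;
    [exact: terms_K_gt0|exact: terms_W_gt0|exact: n_mesh_gt0].
rewrite /compositionsM; apply: runs_weaken.
  apply: runs_bind => [|u1]; first by apply: compP; rewrite size_map size_tuple.
  apply: runs_bind => [|u2]; first by apply: compP; rewrite size_map size_tuple.
  by account.
- by rewrite addn0 mul2n addnn.
- exact: leq_maxl.
Qed.

End Fourier.

(** * Estimates of the costs *)

Section Estimates.
Local Open Scope nat_scope.

(** The sum of e (e + 3) (d + 1 - e) over e <= s equals
(d + 1) s (s + 1) (s + 5) / 3 - s (s + 1) (s^2 + 5 s + 2) / 4; here s = r - 1,
and both sides are arranged to avoid division and subtraction. *)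
Lemma rows_cost_closed d r : r <= d.+2 ->
  12 * rows_cost d r + 3 * (r.-1 * r * (r.-1 ^ 2 + 5 * r.-1 + 2))
  = 4 * d.+1 * (r.-1 * r * (r + 4)).
Proof.
elim: r => [|r IHr] r_le; first by rewrite /rows_cost big_ord0; lia.
rewrite rows_costS mulnDr.
have := IHr (ltnW r_le).
have [e dE] : exists e, d.+1 = r + e by exists (d.+1 - r); lia.
rewrite dE addKn.
case: (r) => [|s] /=; lia.
Qed.

Lemma table_cost_closed d : let k := d.+1 in
  12 * table_cost d + 18 * k = k ^ 4 + 6 * k ^ 3 + 11 * k ^ 2 + 12.
Proof.
rewrite /= /table_cost; have := @rows_cost_closed d d (leqW (leqnSn d)).
case: d => [|d] /=; last nia.
by rewrite /rows_cost big_ord0; lia.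
Qed.

Lemma table_cost_bounds k : 0 < k ->
  k ^ 4 <= 12 * table_cost k.-1 <= 12 * k ^ 4.
Proof.
case: k => // d _; have := table_cost_closed d.
rewrite /= => E.
apply/andP; split; nia.
Qed.

(** As the number of nodes is even and positive, n / 2 + 1 <= n, so that the
differentiation of the trigonometric polynomials costs O(m k n). *)
Lemma composition_cost_bounds (F : nat -> nat) m k n :
  0 < m -> 0 < k -> 0 < n -> ~~ odd n ->
  let cost := composition_cost F m k n in
  m * k ^ 4 * n + m * k * F n <= 6 * cost /\
  cost <= 20 * (m * k ^ 4 * n + m * k * F n).
Proof.
move=> m_gt0 k_gt0 n_gt0 n_even.
have /andP[lo hi] := table_cost_bounds k_gt0.
have k3_le_k4 : k * (k * k) <= k ^ 4 by rewrite !expnS expn0 muln1; nia.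
have kk : k <= k * k by nia.
rewrite /composition_cost /horner_cost (prednK k_gt0).
split.
  have : m * k ^ 4 * n <= m * (12 * table_cost k.-1) * n.
    by rewrite leq_mul // leq_mul.
  by move: (table_cost _) (k.-1 * _) (m.-1 * _) => T x y; nia.
move: (table_cost _) hi {lo} => T hi.
have kX : k <= k ^ 4 by nia.
have hX : m.-1 * (k * k.+1) <= 2 * (m * k ^ 4) by nia.
have tX : m * T <= m * k ^ 4 by nia.
have nX : k.-1 * (4 * n./2.+1) <= 4 * (k ^ 4 * n) by nia.
have X1 : k ^ 4 <= m * k ^ 4 by nia.
move: (k ^ 4) => K in hi k3_le_k4 kX hX tX nX X1 *.
have a1 : n * (m.-1 * (k * k.+1)) <= n * (2 * (m * K)) by rewrite leq_mul.
have a2 : n * (m * T) <= n * (m * K) by rewrite leq_mul.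
have a3 : m * (k.-1 * (4 * n./2.+1)) <= m * (4 * (K * n)) by rewrite leq_mul.
have a4 : n * k <= n * (m * K) by rewrite leq_mul //; lia.
have a5 : n <= n * k by nia.
have a6 : k <= n * k by nia.
lia.
Qed.

(** The middle row, e = k / 2 rounded down, has at least (k^2 - 1) / 4
coefficients; the linear term serves k <= 2, where no row is computed beyond
the second. *)
Lemma rows_peak_bound k : k ^ 2 <= 5 * rows_peak k.-1 k.-1 + 2 * k.
Proof.
have [k_le2|k_gt2] := leqP k 2; first by nia.
have half_lt : k./2 < k.-1 by lia.
have := leq_bigmax (Ordinal half_lt) (F := fun e : 'I_k.-1 => e * (k.-1.+1 - e)).
rewrite -/(rows_peak k.-1 k.-1) /= prednK; last by lia.
have := odd_double_half k; move: (k./2) => h; move: (rows_peak _ _) => p.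
move=> kE; have [e [eE e1]] : exists e, k - h = h + e /\ e <= 1.
  by exists (odd k : nat); case: (odd k) kE => /=; lia.
have -> : k = 2 * h + e by lia.
by rewrite (_ : 2 * h + e - h = h + e) => [|]; [nia|lia].
Qed.

Lemma storage_cost_ge R nfft_ops nfft_work (P : composition_data R) :
  terms_W P * n_mesh P + terms_W P ^ 2
    <= 6 * storage_cost nfft_ops nfft_work P.
Proof.
have [_ + _] := runs_compositionsM nfft_ops nfft_work P
  (leqnn (live (initial_usage P))).
rewrite -/(storage_cost _ _ P) /initial_usage /= geq_max => /andP[init rows].
have := rows_peak_bound (terms_W P); have := n_mesh_gt0 P; nia.
Qed.

Lemma arithmetic_costE R nfft_ops nfft_work (P : composition_data R) :
  arithmetic_cost nfft_ops nfft_work P =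
  2 * composition_cost nfft_ops (terms_K P) (terms_W P) (n_mesh P).
Proof.
by have [] := runs_compositionsM nfft_ops nfft_work P
  (leqnn (live (initial_usage P))).
Qed.

End Estimates.

(** A two-sided bound of [F n] by [n ln n] for large [n] extends to all even
positive [n] up to a multiple of [n]: below the threshold [N], both [F n] and
[ln n] are bounded by constants. *)
Lemma Theta_even_bounds (R : realType) (F : nat -> nat) :
  ((fun n => (F n)%:R) : nat -> R^o)
    \is 'Theta_(within [set n | ~~ odd n] \oo)
          ((fun n => n%:R * ln n%:R) : nat -> R^o) ->
  exists2 a : R, 0 < a & forall n, (0 < n)%N -> ~~ odd n ->
    (F n)%:R <= a * (n%:R * ln n%:R + n%:R) /\
    n%:R * ln n%:R <= a * ((F n)%:R + n%:R).
Proof.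
rewrite qualifE => /asboolP[[l u] /= /andP[l_gt0 u_gt0] [N _ FN]].
have [c1 [c2 [c1_gt0 c2_gt0 {}FN]]] : exists c1 c2 : R, [/\ 0 < c1, 0 < c2 &
    forall n, (N <= n)%N -> ~~ odd n ->
      c1 * `|n%:R * ln n%:R| <= (F n)%:R /\ (F n)%:R <= c2 * `|n%:R * ln n%:R|].
  (* The constants of the asymptotic notation, seen as elements of [R]. *)
  by exists l, u; split=> // n Nn n_even; have := FN n Nn n_even; rewrite normr_nat.
have lnN : 0 <= ln N.+1%:R :> R by rewrite ln_ge0 // ler1n.
set M : R := \sum_(i < N) (F i)%:R.
have M_ge0 : 0 <= M by rewrite sumr_ge0.
have ci_gt0 : 0 < c1^-1 by rewrite invr_gt0.
exists (c1^-1 + c2 + M + ln N.+1%:R) => [|n n_gt0 n_even]; first by lra.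
have n_ge1 : 1 <= n%:R :> R by rewrite ler1n.
have F_ge0 : 0 <= (F n)%:R :> R by [].
have ln_n : 0 <= ln n%:R :> R by rewrite ln_ge0.
have nln_ge0 : 0 <= n%:R * ln n%:R :> R by rewrite mulr_ge0.
have [Nn|nN] := leqP N n.
  have [] := FN n Nn n_even.
  rewrite ger0_norm // => lo hi.
  have {}lo : n%:R * ln n%:R <= c1^-1 * (F n)%:R :> R.
    by rewrite ler_pdivlMl.
  split; nra.
have FM : (F n)%:R <= M.
  rewrite /M (bigD1 (Ordinal nN)) //= lerDl sumr_ge0 //.
have lnM : ln n%:R <= ln N.+1%:R :> R.
  by rewrite ler_ln ?posrE ?ltr0n // ler_nat ltnW // ltnW.
split; nra.
Qed.

Theorem theorem5p4 (R : realType) (nfft_ops nfft_work : nat -> nat)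
    (nfft_complexity :
      ((fun n => (nfft_ops n)%:R) : nat -> R^o)
        \is 'Theta_(within [set n | ~~ odd n] \oo)
              ((fun n => n%:R * ln n%:R) : nat -> R^o)) :
  (((fun P => (arithmetic_cost nfft_ops nfft_work P)%:R) :
       composition_data R -> R^o)
     \is 'Theta_(globally [set: composition_data R])
           ((fun P => let m := (terms_K P)%:R in
                      let k := (terms_W P)%:R in
                      let n := (n_mesh P)%:R in
                      m * k ^+ 4 * n + m * k * (n * ln n))
              : composition_data R -> R^o))
  /\
  (((fun P => (storage_cost nfft_ops nfft_work P)%:R) :
       composition_data R -> R^o)
     \is 'Omega_(globally [set: composition_data R])
           ((fun P => let k := (terms_W P)%:R in
                      let n := (n_mesh P)%:R in
                      k * n + k ^+ 2)
              : composition_data R -> R^o)).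
Proof.
have [a a_gt0 nfft_bounds] := Theta_even_bounds nfft_complexity.
split; rewrite qualifE; apply/asboolP; last first.
  exists 6^-1 => [|P _] /=; first by rewrite invr_gt0.
  rewrite !ger0_norm //.
  rewrite mulrC ler_pdivrMr // -natrX -!natrM -natrD ler_nat [leqRHS]mulnC.
  exact: storage_cost_ge.
exists ((12 * (1 + a))^-1, 40 * (1 + a)) => [|P _] /=.
  by apply/andP; split; rewrite ?invr_gt0; lra.
have n_gt0 := n_mesh_gt0 P; have n_even := n_mesh_even P.
have [F_le ln_le] := nfft_bounds _ n_gt0 n_even.
have [lo hi] := composition_cost_bounds nfft_ops (terms_K_gt0 P) (terms_W_gt0 P)
  n_gt0 n_even.
have Yn_le_X : (terms_K P * terms_W P * n_mesh P
    <= terms_K P * terms_W P ^ 4 * n_mesh P)%N.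
  by rewrite leq_mul // leq_mul // -{1}(expn1 (terms_W P)) leq_pexp2l ?terms_W_gt0.
move: lo hi; rewrite arithmetic_costE; move: (composition_cost _ _ _ _) => C.
rewrite -(ler_nat R) natrM in Yn_le_X.
rewrite -!(ler_nat R) !(natrD, natrM) -natrX -!natrM.
set X : R := (_ * _ ^ _ * _)%:R in Yn_le_X *.
set Y : R := (_ * _)%:R in Yn_le_X *.
rewrite !(natrM _ (_ * _) (nfft_ops _)) !(natrM _ _ C) -/Y => lo hi.
have L_ge0 : 0 <= (n_mesh P)%:R * ln (n_mesh P)%:R :> R.
  by rewrite mulr_ge0 // ln_ge0 // ler1n.
have X_ge0 : 0 <= X by []; have Y_ge0 : 0 <= Y by [].
(* The error terms of order Y n are at most X. *)
have YL_le := ler_wpM2l Y_ge0 ln_le; have YF_le := ler_wpM2l Y_ge0 F_le.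
have YF_ge0 : 0 <= Y * (nfft_ops (n_mesh P))%:R by rewrite mulr_ge0.
rewrite !ger0_norm //; last by rewrite addr_ge0 // mulr_ge0.
move: (n_mesh P)%:R (nfft_ops _)%:R (_ * ln _) => n F L in YL_le YF_le.
split; first rewrite ler_pdivrMl; nra.
Qed.
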